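(* Let $\{f_n\}_{n\ge 1}$ be a family of functions $f_n:\mathbb{R}^n\to\mathbb{R}$ satisfying the homogeneity axiom (M-1), the symmetry axiom (M-2), the translation invariance axiom (M-3) and the condensation axiom (M-4). Then for every $n\ge 1$ and all $(x_1,\dots,x_n)\in\mathbb{R}^n$, $$f_n(x_1,\dots,x_n)=\frac{x_1+\cdots+x_n}{n}.$$
   Context: The axioms for a family $\{f_n\}_{n\ge1}$, $f_n:\mathbb{R}^n\to\mathbb{R}$, are as follows. (M-1) Homogeneity: $f_n(\lambda x_1,\dots,\lambda x_n)=\lambda f_n(x_1,\dots,x_n)$ for all $n\ge1$, all $(x_1,\dots,x_n)\in\mathbb{R}^n$ and all $\lambda\in\mathbb{R}$. (M-2) Symmetry: $f_n(x_1,\dots,x_n)=f_n(x_{\sigma(1)},\dots,x_{\sigma(n)})$ for all $n\ge1$, all $(x_1,\dots,x_n)\in\mathbb{R}^n$ and all permutations $\sigma$ of $\{1,\dots,n\}$. (M-3) Translation invariance: $f_n(x_1+c,\dots,x_n+c)=f_n(x_1,\dots,x_n)+c$ for all $n\ge1$, all $(x_1,\dots,x_n)\in\mathbb{R}^n$ and all $c\in\mathbb{R}$. (M-4) Condensation: for all $n>m\ge1$ and all $(x_1,\dots,x_n)\in\mathbb{R}^n$, $$f_n(x_1,\dots,x_n)=f_n\big(\underbrace{f_m(x_1,\dots,x_m),\dots,f_m(x_1,\dots,x_m)}_{m\text{ times}},x_{m+1},\dots,x_n\big).$$ *)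

(* Defs.v *)
From mathcomp Require Import all_boot all_order all_algebra all_fingroup.
From mathcomp Require Import reals.

Set Implicit Arguments.
Unset Strict Implicit.
Unset Printing Implicit Defensive.

Import GRing.Theory Num.Theory.

Local Open Scope ring_scope.

(* A family {f_n}_{n >= 1} is a map [f] defined at every [n : nat]; its value
   at [n = 0] is junk, and every axiom is restricted to [1 <= n]. *)

Definition homogeneous (R : realType) (f : forall n : nat, 'rV[R]_n -> R) :
    Prop :=
  forall (n : nat) (x : 'rV[R]_n) (l : R),
    (1 <= n)%N -> f n (l *: x) = l * f n x.

(* [col_perm s x] is the row vector (x_{s(1)}, ..., x_{s(n)}). *)
Definition symmetric_family (R : realType)
    (f : forall n : nat, 'rV[R]_n -> R) : Prop :=
  forall (n : nat) (x : 'rV[R]_n) (s : 'S_n),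
    (1 <= n)%N -> f n x = f n (col_perm s x).

Definition translation_invariant (R : realType)
    (f : forall n : nat, 'rV[R]_n -> R) : Prop :=
  forall (n : nat) (x : 'rV[R]_n) (c : R),
    (1 <= n)%N -> f n (x + const_mx c) = f n x + c.

Definition first_coords (R : realType) (m n : nat) (le_mn : (m <= n)%N)
    (x : 'rV[R]_n) : 'rV[R]_m :=
  \row_(j < m) x 0 (widen_ord le_mn j).

Definition replace_first (R : realType) (m n : nat) (a : R) (x : 'rV[R]_n) :
    'rV[R]_n :=
  \row_(i < n) if (i < m)%N then a else x 0 i.

Definition condensation (R : realType) (f : forall n : nat, 'rV[R]_n -> R) :
    Prop :=
  forall (m n : nat) (lt_mn : (m < n)%N) (x : 'rV[R]_n),
    (1 <= m)%N ->
    f n x = f n (replace_first m (f m (first_coords (ltnW lt_mn) x)) x).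

(* Main.v *)
(* By induction on the arity.  Condensing the first n of n + 1 arguments to
   their mean a, translation invariance and homogeneity give
   f (x_1, ..., x_(n+1)) = a + (x_(n+1) - a) k with k = f (0, ..., 0, 1).
   Evaluating at (1, 0, ..., 0), where symmetry forces the value k, yields
   k = (1 - k) / n, that is k = 1 / (n + 1). *)

Require Import Defs.
From mathcomp Require Import all_boot all_order all_algebra all_fingroup.
From mathcomp Require Import reals.
From mathcomp Require Import ring.

Set Implicit Arguments.
Unset Strict Implicit.
Unset Printing Implicit Defensive.

Import GRing.Theory Num.Theory.

Local Open Scope ring_scope.

(** Homogeneity with scalar 0 gives [f n 0 = 0]; translating the zero vector by [c] does the
    rest. *)
Lemma family_const (R : realType) (f : forall n : nat, 'rV[R]_n -> R)
    (f_homogeneous : homogeneous f) (f_translation : translation_invariant f)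
    (n : nat) (n_ge1 : (1 <= n)%N) (c : R) :
  f n (const_mx c) = c.
Proof.
rewrite -[const_mx c]add0r f_translation // -(scale0r (0 : 'rV[R]_n)).
by rewrite f_homogeneous // mul0r add0r.
Qed.

(** Puts the condensed vector in the scaled and translated form to which homogeneity and translation
    invariance apply. *)
Lemma replace_first_max (R : realType) (n : nat) (a : R) (x : 'rV[R]_n.+1) :
  replace_first n a x =
  (x 0 ord_max - a) *: delta_mx 0 ord_max + const_mx a.
Proof.
apply/rowP => i; rewrite !mxE /=.
have [lt_in|le_ni] := ltnP i n.
  have /negPf -> : i != ord_max by rewrite -val_eqE /= ltn_eqF.
  by rewrite mulr0 add0r.
have -> : i = ord_max by apply/val_inj/eqP; rewrite eqn_leq -ltnS ltn_ord.
by rewrite eqxx mulr1 subrK.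
Qed.

Lemma family_recr (R : realType) (f : forall n : nat, 'rV[R]_n -> R)
    (f_homogeneous : homogeneous f) (f_translation : translation_invariant f)
    (f_condensation : condensation f) (n : nat) (n_ge1 : (1 <= n)%N)
    (x : 'rV[R]_n.+1) (a := f n (first_coords (leqnSn n) x)) :
  f n.+1 x = (x 0 ord_max - a) * f n.+1 (delta_mx 0 ord_max) + a.
Proof.
rewrite (f_condensation _ _ (ltnSn n) x n_ge1).
rewrite (bool_irrelevance (ltnW _) (leqnSn n)) -/a replace_first_max.
by rewrite f_translation // f_homogeneous.
Qed.

(** The transposition of [i] and [j] carries one basis vector to the other. *)
Lemma family_delta (R : realType) (f : forall n : nat, 'rV[R]_n -> R)
    (f_symmetric : symmetric_family f) (n : nat) (i j : 'I_n) :
  f n (delta_mx 0 i) = f n (delta_mx 0 j).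
Proof.
have n_ge1 : (1 <= n)%N by apply: leq_ltn_trans (ltn_ord i).
rewrite (f_symmetric _ (delta_mx 0 i) (tperm i j) n_ge1); congr (f n _).
apply/rowP => l; rewrite !mxE /=; congr (_%:R); congr nat_of_bool.
by rewrite -(inj_eq (@perm_inj _ (tperm i j))) tpermK tpermL.
Qed.

Theorem proposition2p3 (R : realType) (f : forall n : nat, 'rV[R]_n -> R)
    (f_homogeneous : homogeneous f)
    (f_symmetric : symmetric_family f)
    (f_translation : translation_invariant f)
    (f_condensation : condensation f)
    (n : nat) (n_ge1 : (1 <= n)%N) (x : 'rV[R]_n) :
  f n x = (\sum_(i < n) x 0 i) / n%:R.
Proof.
elim: n n_ge1 x => [//|[|n] IHn] _ x.
  (* In arity 1 every vector is constant. *)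
  have -> : x = const_mx (x 0 0) by apply/rowP => i; rewrite mxE ord1.
  by rewrite family_const // big_ord1 mxE divr1.
have frec := family_recr f_homogeneous f_translation f_condensation (ltn0Sn n).
have mean_first (y : 'rV[R]_n.+2) : f n.+1 (first_coords (leqnSn _) y) =
    (\sum_(i < n.+1) y 0 (widen_ord (leqnSn _) i)) / n.+1%:R.
  by rewrite IHn //; congr (_ / _); apply: eq_bigr => i _; rewrite mxE.
have n1_neq0 : n.+1%:R != 0 :> R by rewrite pnatr_eq0.
have n2_neq0 : n.+2%:R != 0 :> R by rewrite pnatr_eq0.
set k := f n.+2 (delta_mx 0 ord_max) in frec.
have k_eq : k = n.+2%:R^-1.
  (* The arity is at least 2, so [ord0] is not [ord_max]: the last coordinate is 0 and the first
     [n.+1] have mean 1/(n+1). *)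
  have := frec (delta_mx 0 ord0).
  rewrite (family_delta f_symmetric ord0 ord_max) -/k mean_first.
  rewrite big_ord_recl big1 => [|i _]; last by rewrite mxE.
  rewrite !mxE /= addr0 sub0r => keq.
  apply: (mulIf n2_neq0); rewrite mulVf // -[n.+2]addn1 natrD mulrDr mulr1.
  (* Only the [k] multiplied by [n.+1] is expanded: the product becomes 1 - k, which cancels the
     remaining [k]. *)
  by rewrite {1}keq; field; rewrite nat1r.
rewrite frec k_eq mean_first [in RHS]big_ord_recr /=.
set s := \sum_(i < n.+1) _.
(* The weight of [s] is (1 - 1/(n+2))/(n+1) = 1/(n+2), the same as that of the last coordinate. *)
by field; rewrite -natrD nat1r !pnatr_eq0.
Qed.
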